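(* Let the optimizer have $m=2$ actions $N,Y$, let the learner have $n=3$ actions $A,B,C$, and let $u_L$ be given by $u_L(N,A)=0$, $u_L(Y,A)=0$, $u_L(N,B)=-1/6$, $u_L(Y,B)=1/3$, $u_L(N,C)=-1/2$, $u_L(Y,C)=1/2$. Then the mean-based menu $\mathcal{M}_{\mathrm{MB}}$ of $u_L$ is a polytope.
   Context: $\Delta_m,\Delta_n$ are the simplices of mixed strategies of the optimizer and the learner; $\Delta_{mn}$ is the set of probability distributions over pairs of (optimizer, learner) actions; $x\otimes y$ is the product distribution; $u_L$ is extended bilinearly. $\mathrm{BR}_L(x)=\arg\max_{j\in[n]}u_L(x,j)$ (set of pure learner actions); $\mathrm{BR}_L(0)$ is the set of all learner actions. Mean-based menu. A trajectory is a finite non-empty list $\tau=\{(x_1,t_1,b_1),\dots,(x_k,t_k,b_k)\}$ with $x_i\in\Delta_m$, $t_i\in\mathbb{R}_+$, $b_i\in[n]$. Put $\overline{x}_i=\sum_{j=1}^i x_jt_j/\sum_{j=1}^it_j$ and $\overline{x}_0=0$. $\tau$ is valid if $b_i\in\mathrm{BR}_L(\overline{x}_{i-1})$ and $b_i\in\mathrm{BR}_L(\overline{x}_i)$ for every $i$. Its profile is $\mathrm{Prof}(\tau)=\sum_{i=1}^kt_i(x_i\otimes b_i)/\sum_{i=1}^kt_i\in\Delta_{mn}$. $\mathcal{M}_{\mathrm{MB}}$ is the convex closure (closed convex hull) of $\{\mathrm{Prof}(\tau):\tau\text{ valid}\}$. A polytope is a bounded intersection of finitely many half-spaces. *)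

(* Defs.v *)
From HB Require Import structures.
From mathcomp Require Import all_boot all_order all_algebra.
From mathcomp Require Import boolp classical_sets reals topology normedtype convex.

Set Implicit Arguments.
Unset Strict Implicit.
Unset Printing Implicit Defensive.

Import Order.TTheory GRing.Theory Num.Theory.
Import numFieldNormedType.Exports.

Local Open Scope classical_set_scope.
Local Open Scope ring_scope.

Section Games.
Variables (R : realType) (m n : nat).

Definition simplex (k : nat) : set 'rV[R]_k :=
  [set x | (forall i, 0 <= x 0 i) /\ \sum_(i < k) x 0 i = 1].

Definition pure (k : nat) (j : 'I_k) : 'rV[R]_k := delta_mx 0 j.

(* Entry (i, j) is x_i * y_j: joint distributions over action pairs live in
   'M[R]_(m, n). *)
Definition otimes (x : 'rV[R]_m) (y : 'rV[R]_n) : 'M[R]_(m, n) := x^T *m y.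

(* [u i j] is the learner's payoff when the optimizer plays i and the learner
   plays j. *)
Definition payoff (u : 'M[R]_(m, n)) (x : 'rV[R]_m) (y : 'rV[R]_n) : R :=
  \sum_(i < m) \sum_(j < n) x 0 i * y 0 j * u i j.

Definition BR (u : 'M[R]_(m, n)) (x : 'rV[R]_m) : set 'I_n :=
  [set j | forall k, payoff u x (pure k) <= payoff u x (pure j)].

Lemma BR0 (u : 'M[R]_(m, n)) : BR u 0 = setT.
Proof.
apply/seteqP; split => // j _ k.
by rewrite /payoff; apply: ler_sum => i _; apply: ler_sum => l _;
  rewrite ?mxE !mul0r.
Qed.

Definition segment : Type := 'rV[R]_m * R * 'I_n.
Definition mix (s : segment) : 'rV[R]_m := s.1.1.
Definition dur (s : segment) : R := s.1.2.
Definition act (s : segment) : 'I_n := s.2.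

(* Durations are strictly positive: a segment of duration 0 changes neither the
   averages nor the profile, but as a first segment it would make the average
   after it undefined. *)
Definition trajectory (tau : seq segment) : Prop :=
  tau <> [::] /\
  forall i s, onth tau i = Some s -> simplex (mix s) /\ 0 < dur s.

Definition total_time (tau : seq segment) : R := \sum_(s <- tau) dur s.

(* For the empty list this is 0^-1 *: 0 = 0, the convention for the average at
   time 0. *)
Definition avg (tau : seq segment) : 'rV[R]_m :=
  (total_time tau)^-1 *: \sum_(s <- tau) dur s *: mix s.

Lemma avg_nil : avg [::] = 0.
Proof. by rewrite /avg big_nil scaler0. Qed.

Definition valid (u : 'M[R]_(m, n)) (tau : seq segment) : Prop :=
  forall i s, onth tau i = Some s ->
    BR u (avg (take i tau)) (act s) /\ BR u (avg (take i.+1 tau)) (act s).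

Definition prof (tau : seq segment) : 'M[R]_(m, n) :=
  (total_time tau)^-1 *:
    \sum_(s <- tau) dur s *: otimes (mix s) (pure (act s)).

Definition convex_hull (S : set 'M[R]_(m, n)) : set 'M[R]_(m, n) :=
  smallest (@convex_set R 'M[R]_(m, n)) S.

Definition mb_menu (u : 'M[R]_(m, n)) : set 'M[R]_(m, n) :=
  closure (convex_hull
    [set p | exists tau, [/\ trajectory tau, valid u tau & p = prof tau]]).

Definition halfspace (a : 'M[R]_(m, n)) (c : R) : set 'M[R]_(m, n) :=
  [set p | \sum_(i < m) \sum_(j < n) a i j * p i j <= c].

Definition polytope (P : set 'M[R]_(m, n)) : Prop :=
  bounded_set P /\
  exists hs : seq ('M[R]_(m, n) * R),
    (forall h, h \in hs -> h.1 != 0) /\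
    P = \bigcap_(h in [set` hs]) halfspace h.1 h.2.

End Games.

Definition actN : 'I_2 := @Ordinal 2 0 isT.
Definition actY : 'I_2 := @Ordinal 2 1 isT.

Definition actA : 'I_3 := @Ordinal 3 0 isT.
Definition actB : 'I_3 := @Ordinal 3 1 isT.
Definition actC : 'I_3 := @Ordinal 3 2 isT.

(* Main.v *)
Require Import Defs.
From mathcomp Require Import all_boot all_order all_algebra.
From mathcomp Require Import boolp classical_sets reals topology normedtype convex.
From mathcomp Require Import interval_inference ring lra.

Set Implicit Arguments.
Unset Strict Implicit.
Unset Printing Implicit Defensive.

Import Order.TTheory GRing.Theory Num.Theory.
Import numFieldNormedType.Exports.
Local Open Scope ring_scope.
Local Open Scope convex_scope.

(** Write the cumulative play of the optimizer as a point (a, b) of the quadrant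
    (time spent on N, on Y). The best responses A, B, C are optimal on the cones
    2b <= a, [a <= 2b and b <= 2a] and 2a <= b, and a trajectory is a monotone
    path each of whose segments stays in the cone of its action. Let v_A, v_B,
    v_C be the displacements made under A, B, C. As B and C are only played
    where a <= 2b, the value of max(0, a - 2b) changes only under A, so it equals
    the value of a - 2b on v_A; likewise max(0, b - 2a) is the value of b - 2a on
    v_C. With nonnegativity these two equations imply the linear inequalities
    defining [thirds_menu]. Conversely every point of [thirds_menu] is a
    combination of one-segment paths inside each cone and of the two paths
    (2,1) under A then (0,3) under B, and (1,2) under C then (3,0) under B,
    which cross B from one of its boundary rays to the other. *)

(** * Half-spaces, convex hulls and closures *)

Lemma halfspace_closed (R : realType) (m n : nat) (a : 'M[R]_(m, n)) (c : R) :
  closed (halfspace a c).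
Proof.
have /continuous_closedP cf :
    continuous (fun p : 'M[R]_(m, n) => \sum_i \sum_j a i j * p i j).
  have addc := @add_continuous R^o.
  refine (@continuous_big _ _ _ _ _ addc _ _
    (fun i (p : 'M[R]_(m, n)) => \sum_j a i j * p i j) _) => i _.
  refine (@continuous_big _ _ _ _ _ addc _ _
    (fun j (p : 'M[R]_(m, n)) => a i j * p i j) _) => j _.
  by move=> p; exact: cvgM (cvg_cst _) (@coord_continuous R m n i j p).
exact: cf (@closed_le _ c).
Qed.

Lemma halfspace_convex (R : realType) (m n : nat) (a : 'M[R]_(m, n)) (c : R) :
  convex_set (halfspace a c : set (convex_lmodType 'M[R]_(m, n))).
Proof.
move=> x y l; rewrite !inE /halfspace /= => hx hy.
have -> : \sum_i \sum_j a i j * (x <| l |> y) i j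
    = l%:num * (\sum_i \sum_j a i j * x i j)
      + (1 - l%:num) * (\sum_i \sum_j a i j * y i j).
  rewrite !mulr_sumr -big_split; apply: eq_bigr => i _ /=.
  rewrite !mulr_sumr -big_split; apply: eq_bigr => j _ /=.
  by rewrite !mxE /unstable.onem; ring.
have l0 : 0 <= l%:num by [].
have l1 : l%:num <= 1 by [].
by nra.
Qed.

Lemma sub_convex_hull (R : realType) (m n : nat) (S : set 'M[R]_(m, n)) :
  (S `<=` convex_hull S)%classic.
Proof. exact: sub_gen_smallest. Qed.

Lemma convex_hull_convex (R : realType) (m n : nat) (S : set 'M[R]_(m, n)) :
  convex_set (convex_hull S : set (convex_lmodType 'M[R]_(m, n))).
Proof.
move=> x y l; rewrite !inE => hx hy A [cA SA].
by have := cA x y l; rewrite !inE; apply; [apply: hx|apply: hy].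
Qed.

(** Half-spaces are closed and convex, hence so is [P], which therefore absorbs first the hull of
    [S] and then its closure. The menu is thus found by two inclusions, with no limit argument. *)
Lemma polytope_hull_closure (R : realType) (m n : nat)
    (S P : set 'M[R]_(m, n)) :
  polytope P -> (S `<=` P)%classic -> (P `<=` convex_hull S)%classic ->
  closure (convex_hull S) = P.
Proof.
move=> [_ [hs [_ ->]]] SP PS; apply/seteqP; split; last first.
  by apply: subset_trans PS _; exact: subset_closure.
set P' := (\bigcap_(h in _) _)%classic.
have cP : closed P' by apply: closed_bigI => h _; exact: halfspace_closed.
rewrite [X in (_ `<=` X)%classic](iffLR (closure_id P') cP).
apply: closureS; apply: smallest_sub => // x y l.
rewrite !inE => hx hy h hh.
have := halfspace_convex (a := h.1) (c := h.2) (x := x) (y := y) l.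
by rewrite !inE; apply; [exact: hx|exact: hy].
Qed.

(** * Cones over convex sets *)

(** Membership of [v] at height [t] in the cone over [C]. Keeping the height lets pieces of
    different durations be added without normalising; at height 1 this is membership in [C]. Height
    0 still asks for a point of [C]. *)
Definition conic (R : realType) (V : lmodType R) (C : set V) (t : R) (v : V) :=
  0 <= t /\ exists2 c, C c & v = t *: c.

(** The base point of the sum is the convex combination of the two base points with weights
    [t / (t + u)] and [u / (t + u)]. *)
Lemma conic_add (R : realType) (V : lmodType R) (C : set V) t u v w :
  convex_set (C : set (convex_lmodType V)) ->
  conic C t v -> conic C u w -> conic C (t + u) (v + w).
Proof.
move=> cC [t0 [c Cc ->]] [u0 [d Cd ->]]; split; first exact: addr_ge0.
have [tu|tu] := eqVneq (t + u) 0.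
  move: tu; move/eqP; rewrite paddr_eq0 // => /andP[/eqP-> /eqP->].
  by exists c => //; rewrite addr0 !scale0r addr0.
have tu_gt0 : 0 < t + u by rewrite lt_neqAle eq_sym tu addr_ge0.
have q0 : 0 <= t / (t + u) by rewrite divr_ge0 // ltW.
have q1 : t / (t + u) <= 1 by rewrite ler_pdivrMr // mul1r lerDl.
pose l : {i01 R} := Itv01 q0 q1.
exists ((c : convex_lmodType V) <| l |> d).
  by have := cC c d l; rewrite !inE; apply.
rewrite [RHS]scalerDr !scalerA /= /unstable.onem; congr (_ *: _ + _ *: _).
  by field.
by field.
Qed.

Lemma conicZ (R : realType) (V : lmodType R) (C : set V) a t v :
  0 <= a -> conic C t v -> conic C (a * t) (a *: v).
Proof.
move=> a0 [t0 [c Cc ->]]; split; first exact: mulr_ge0.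
by exists c => //; rewrite scalerA.
Qed.

(** * Trajectories in cumulative coordinates *)

(** Payoffs are linear in [x], so best responses depend only on the ray through [x]; averages can be
    replaced by cumulative positions. *)
Lemma BR_scale (R : realType) (m n : nat) (u : 'M[R]_(m, n)) (c : R)
    (x : 'rV[R]_m) (j : 'I_n) :
  0 < c -> BR u (c *: x) j <-> BR u x j.
Proof.
move=> c0.
have E y : payoff u (c *: x) y = c * payoff u x y.
  rewrite /payoff mulr_sumr; apply: eq_bigr => i _.
  by rewrite mulr_sumr; apply: eq_bigr => k _; rewrite mxE; ring.
split=> h k; have := h k; rewrite !E.
  by rewrite ler_pM2l.
by rewrite ler_pM2l.
Qed.

Definition position (R : realType) (m n : nat) (tau : seq (segment R m n)) :=
  \sum_(s <- tau) dur s *: mix s.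

Definition mass (R : realType) (m n : nat) (tau : seq (segment R m n)) :=
  \sum_(s <- tau) dur s *: otimes (mix s) (pure R (act s)).

(** This is [trajectory] without non-emptiness, so that inductions over prefixes can start at the
    empty list. *)
Definition proper_segments (R : realType) (m n : nat)
    (tau : seq (segment R m n)) :=
  forall i s, onth tau i = Some s -> simplex (mix s) /\ 0 < dur s.

Lemma onth_rcons_last (T : Type) (s : seq T) (x : T) :
  onth (rcons s x) (size s) = Some x.
Proof. by rewrite -cats1 onth_cat ltnn subnn. Qed.

Lemma onth_rconsW (T : Type) (s : seq T) (x y : T) (i : nat) :
  onth s i = Some y -> onth (rcons s x) i = Some y.
Proof.
move=> e; have i_lt : (i < size s)%N by rewrite -onthTE e.
by rewrite -cats1 onth_cat i_lt.
Qed.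

Lemma proper_segments_rcons (R : realType) (m n : nat)
    (tau : seq (segment R m n)) (s : segment R m n) :
  proper_segments (rcons tau s) ->
  [/\ proper_segments tau, simplex (mix s) & 0 < dur s].
Proof.
move=> h; have [hs hd] := h _ _ (onth_rcons_last tau s); split=> //.
by move=> i t /(onth_rconsW s); exact: h.
Qed.

Lemma valid_rcons (R : realType) (m n : nat) (u : 'M[R]_(m, n))
    (tau : seq (segment R m n)) (s : segment R m n) :
  valid u (rcons tau s) ->
  [/\ valid u tau, BR u (avg tau) (act s) & BR u (avg (rcons tau s)) (act s)].
Proof.
move=> h; have [] := h _ _ (onth_rcons_last tau s).
have -> : take (size tau) (rcons tau s) = tau.
  by rewrite -cats1 take_size_cat.
have -> : take (size tau).+1 (rcons tau s) = rcons tau s.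
  by rewrite take_oversize // size_rcons.
move=> h1 h2; split=> // i t e.
have i_lt : (i < size tau)%N by rewrite -onthTE e.
have := h _ _ (onth_rconsW s e).
rewrite -cats1 !takel_cat //; exact: ltnW.
Qed.

Lemma total_time_gt0 (R : realType) (m n : nat) (tau : seq (segment R m n)) :
  proper_segments tau -> tau <> [::] -> 0 < total_time tau.
Proof.
elim/last_ind: tau => [//|tau s IH] /proper_segments_rcons[ht _ ds] _.
rewrite /total_time big_rcons /= -/(total_time tau).
case: tau IH ht => [|t tau] IH ht; first by rewrite /total_time big_nil add0r.
by apply: addr_gt0 => //; apply: IH.
Qed.

Lemma BR_avg (R : realType) (m n : nat) (u : 'M[R]_(m, n))
    (tau : seq (segment R m n)) (j : 'I_n) :
  proper_segments tau -> BR u (avg tau) j <-> BR u (position tau) j.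
Proof.
case: tau => [|s tau] h.
  by rewrite avg_nil /position big_nil.
by apply: BR_scale; rewrite invr_gt0; exact: total_time_gt0.
Qed.

(** * Profiles of paths with one or two segments *)

(** For [v] with positive coordinate sum, this is the segment under [j] whose displacement is [v]:
    mixed strategies sum to 1, which forces the duration. *)
Definition ray_segment (R : realType) (m n : nat) (v : 'rV[R]_m) (j : 'I_n) :
    segment R m n :=
  ((\sum_i v 0 i)^-1 *: v, \sum_i v 0 i, j).

Definition mb_profiles (R : realType) (m n : nat) (u : 'M[R]_(m, n)) :
    set 'M[R]_(m, n) :=
  [set p | exists tau, [/\ trajectory tau, valid u tau & p = prof tau]]%classic.

Lemma ray_segmentK (R : realType) (m n : nat) (v : 'rV[R]_m) (j : 'I_n) :
  0 < \sum_i v 0 i ->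
  dur (ray_segment v j) *: mix (ray_segment v j) = v.
Proof. by move=> v0; rewrite scalerA divff ?scale1r // gt_eqF. Qed.

Lemma ray_segment_simplex (R : realType) (m n : nat) (v : 'rV[R]_m) (j : 'I_n) :
  (forall i, 0 <= v 0 i) -> 0 < \sum_i v 0 i ->
  simplex (mix (ray_segment v j)).
Proof.
move=> v0 vs; split=> [i|].
  by rewrite mxE mulr_ge0 // invr_ge0 ltW.
under eq_bigr do rewrite mxE.
by rewrite -mulr_sumr mulVf // gt_eqF.
Qed.

Lemma otimesZ (R : realType) (m n : nat) (c : R) (x : 'rV[R]_m) (y : 'rV[R]_n) :
  otimes (c *: x) y = c *: otimes x y.
Proof. by rewrite /otimes linearZ -scalemxAl. Qed.

(** The path starts at 0, where every action is a best response, so only its endpoint [v] constrains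
    [j]. *)
Lemma conic_one_ray (R : realType) (m n : nat) (u : 'M[R]_(m, n))
    (v : 'rV[R]_m) (j : 'I_n) :
  (forall i, 0 <= v 0 i) -> 0 < \sum_i v 0 i -> BR u v j ->
  conic (mb_profiles u) (\sum_i v 0 i) (otimes v (pure R j)).
Proof.
move=> v0 vs hj; split; first exact: ltW.
pose tau := [:: ray_segment v j].
have pt : proper_segments tau.
  move=> i s /onth1P[_ <-]; split=> //; exact: ray_segment_simplex.
exists (prof tau).
  exists tau; split=> // i s e.
  have := e => /onth1P[i0 es]; subst i s; rewrite /= avg_nil BR0; split=> //.
  by apply/BR_avg => //; rewrite /position big_seq1 ray_segmentK.
rewrite /prof /total_time !big_seq1 -otimesZ ray_segmentK //.
by rewrite scalerA divff ?scale1r // gt_eqF.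
Qed.

(** The switching point [v] ends the first segment and starts the second, so both actions must be
    best responses there. *)
Lemma conic_two_rays (R : realType) (m n : nat) (u : 'M[R]_(m, n))
    (v w : 'rV[R]_m) (j k : 'I_n) :
  (forall i, 0 <= v 0 i) -> 0 < \sum_i v 0 i ->
  (forall i, 0 <= w 0 i) -> 0 < \sum_i w 0 i ->
  BR u v j -> BR u v k -> BR u (v + w) k ->
  conic (mb_profiles u) (\sum_i v 0 i + \sum_i w 0 i)
    (otimes v (pure R j) + otimes w (pure R k)).
Proof.
move=> v0 vs w0 ws hj hk hk'; split; first by rewrite addr_ge0 ?ltW.
pose s1 := ray_segment v j; pose s2 := ray_segment w k.
have s1K : dur s1 *: mix s1 = v by exact: ray_segmentK.
have s2K : dur s2 *: mix s2 = w by exact: ray_segmentK.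
have p1 : proper_segments [:: s1].
  by move=> i s /onth1P[_ <-]; split=> //; exact: ray_segment_simplex.
have p2 : proper_segments [:: s1; s2].
  move=> [|i] s; first by case=> <-; split=> //; exact: ray_segment_simplex.
  by move=> /onth1P[_ <-]; split=> //; exact: ray_segment_simplex.
exists (prof [:: s1; s2]).
  exists [:: s1; s2]; split=> // i s.
  case: i => [|i] /=.
    case=> <-; rewrite avg_nil BR0; split=> //.
    by apply/BR_avg => //; rewrite /position big_seq1 s1K.
  move=> /onth1P[-> <-] /=; split.
    by apply/BR_avg => //; rewrite /position big_seq1 s1K.
  by apply/BR_avg => //; rewrite /position big_cons big_seq1 s1K s2K.
rewrite /prof /total_time !big_cons !big_nil -!otimesZ s1K s2K !addr0.
by rewrite scalerA divff ?scale1r // gt_eqF // addr_gt0.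
Qed.

(** * The best-response cones of the game *)

Lemma sum_optimizer (R : realType) (F : 'I_2 -> R) :
  \sum_i F i = F actN + F actY.
Proof.
by rewrite !big_ord_recr big_ord0 /= add0r; congr (F _ + F _); exact: val_inj.
Qed.

Lemma sum_learner (R : realType) (F : 'I_3 -> R) :
  \sum_j F j = F actA + F actB + F actC.
Proof.
rewrite !big_ord_recr big_ord0 /= add0r.
by congr (F _ + F _ + F _); exact: val_inj.
Qed.

Lemma learner_ind (P : 'I_3 -> Prop) :
  P actA -> P actB -> P actC -> forall j, P j.
Proof.
move=> hA hB hC [[|[|[|k]]] hk] //.
- by rewrite (_ : Ordinal hk = actA) //; exact: val_inj.
- by rewrite (_ : Ordinal hk = actB) //; exact: val_inj.
- by rewrite (_ : Ordinal hk = actC) //; exact: val_inj.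
Qed.

Lemma optimizer_ind (P : 'I_2 -> Prop) : P actN -> P actY -> forall i, P i.
Proof.
move=> hN hY [[|[|k]] hk] //.
- by rewrite (_ : Ordinal hk = actN) //; exact: val_inj.
- by rewrite (_ : Ordinal hk = actY) //; exact: val_inj.
Qed.

Lemma otimes_pureE (R : realType) (m n : nat) (x : 'rV[R]_m) (j k : 'I_n) i :
  otimes x (pure R j) i k = x 0 i * (k == j)%:R.
Proof. by rewrite !mxE big_ord1 !mxE eqxx. Qed.

(** All that the later arguments use of the payoffs. The learner switches where the frequency of Y
    is one third and two thirds. *)
Definition thirds_rule (R : realType) (u : 'M[R]_(2, 3)) :=
  forall x : 'rV[R]_2, (forall i, 0 <= x 0 i) ->
  [/\ BR u x actA <-> 2 * x 0 actY <= x 0 actN,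
      BR u x actB <-> x 0 actN <= 2 * x 0 actY /\ x 0 actY <= 2 * x 0 actN &
      BR u x actC <-> 2 * x 0 actN <= x 0 actY].

Lemma payoff_pure (R : realType) (u : 'M[R]_(2, 3)) x j :
  payoff u x (pure R j) = x 0 actN * u actN j + x 0 actY * u actY j.
Proof.
rewrite /payoff sum_optimizer !sum_learner.
by elim/learner_ind: j; rewrite !mxE /=; ring.
Qed.

(** At (a, b) the payoffs of A, B, C are 0, (2b - a)/6 and (b - a)/2. A and B tie at a = 2b, B and C
    at b = 2a; on the quadrant the comparison of A with C follows from these two. *)
Lemma thirds_rule_uL (R : realType) (uL : 'M[R]_(2, 3))
    (hNA : uL actN actA = 0) (hYA : uL actY actA = 0)
    (hNB : uL actN actB = - (1 / 6)) (hYB : uL actY actB = 1 / 3)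
    (hNC : uL actN actC = - (1 / 2)) (hYC : uL actY actC = 1 / 2) :
  thirds_rule uL.
Proof.
move=> x x0; have := x0 actN; have := x0 actY => xY xN.
have E j : BR uL x j <->
    [/\ payoff uL x (pure R actA) <= payoff uL x (pure R j),
        payoff uL x (pure R actB) <= payoff uL x (pure R j) &
        payoff uL x (pure R actC) <= payoff uL x (pure R j)].
  split=> [h|[hA hB hC]]; first by split; exact: h.
  by apply: learner_ind.
split; rewrite E !payoff_pure hNA hYA hNB hYB hNC hYC.
- by split=> [[]|h]; [|split]; lra.
- by split=> [[]|[]]; [split|split]; lra.
- by split=> [[]|h]; [|split]; lra.
Qed.

(** * Equations satisfied by valid trajectories *)

Lemma mass_rcons (R : realType) (m n : nat) (tau : seq (segment R m n)) s i j :
  mass (rcons tau s) i j =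
  mass tau i j + dur s * (mix s 0 i * (j == act s)%:R).
Proof. by rewrite /mass big_rcons /= !mxE -otimes_pureE !mxE. Qed.

(** Each segment puts its whole displacement in the column of its action. Hence conditions on
    positions become conditions on [mass] alone. *)
Lemma position_mass (R : realType) (m n : nat) (tau : seq (segment R m n)) i :
  position tau 0 i = \sum_j mass tau i j.
Proof.
rewrite /position /mass summxE.
under [RHS]eq_bigr do rewrite summxE.
rewrite exchange_big; apply: eq_bigr => s _ /=.
rewrite (bigD1 (act s)) //= big1 => [|j /negPf js]; last first.
  by rewrite mxE otimes_pureE js !mulr0.
by rewrite addr0 [LHS]mxE [RHS]mxE otimes_pureE eqxx mulr1.
Qed.

Lemma total_time_mass (R : realType) (m n : nat) (tau : seq (segment R m n)) :
  proper_segments tau ->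
  total_time tau = \sum_i \sum_j mass tau i j.
Proof.
move=> h; under eq_bigr do rewrite -position_mass.
elim/last_ind: tau h => [|tau s IH].
  by move=> _; rewrite /total_time /position !big_nil big1 // => i; rewrite mxE.
move=> /proper_segments_rcons[ht [_ hs] _].
rewrite /total_time /position !big_rcons /=.
rewrite -/(total_time tau) -/(position tau) IH //.
rewrite -[dur s in LHS]mulr1 -hs mulr_sumr -big_split.
by apply: eq_bigr => i _; rewrite !mxE.
Qed.

Lemma mass_ge0 (R : realType) (m n : nat) (tau : seq (segment R m n)) i j :
  proper_segments tau -> 0 <= mass tau i j.
Proof.
elim/last_ind: tau => [|tau s IH] h; first by rewrite /mass big_nil mxE.
have [ht [hs _] hd] := proper_segments_rcons h.
by rewrite mass_rcons addr_ge0 ?IH // !mulr_ge0 // ltW.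
Qed.

Lemma position_ge0 (R : realType) (m n : nat) (tau : seq (segment R m n)) i :
  proper_segments tau -> 0 <= position tau 0 i.
Proof.
by move=> h; rewrite position_mass sumr_ge0 // => j _; exact: mass_ge0.
Qed.

(** Induction on the last segment: both its endpoints lie in the cone of its action, so each maximum
    takes the same branch before and after, and its increment is linear in the displacement. *)
Lemma valid_mass (R : realType) (u : 'M[R]_(2, 3)) (tau : seq (segment R 2 3)) :
  thirds_rule u -> proper_segments tau -> valid u tau ->
  let V := position tau in let W := mass tau in
  W actN actA - 2 * W actY actA = Num.max 0 (V 0 actN - 2 * V 0 actY) /\
  W actY actC - 2 * W actN actC = Num.max 0 (V 0 actY - 2 * V 0 actN).
Proof.
move=> hu; elim/last_ind: tau => [|tau s IH] /=.
  by move=> _ _; rewrite /position /mass !big_nil !mxE mulr0 subr0 maxxx.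
move=> hp hv; have [ht [hs _] hd] := proper_segments_rcons hp.
have [hvt h1 h2] := valid_rcons hv.
have [] := IH ht hvt.
move: h1 h2; rewrite (BR_avg _ _ ht) (BR_avg _ _ hp).
have V0 i := position_ge0 i ht; have V0' i := position_ge0 i hp.
move: (V0 actN) (V0 actY) (V0' actN) (V0' actY).
have := hu _ V0; have := hu _ V0'.
have VE i : position (rcons tau s) 0 i
    = position tau 0 i + dur s * mix s 0 i.
  by rewrite /position big_rcons !mxE.
rewrite !mass_rcons !VE.
move: (mass _ _ _) (mass _ _ _) (mass _ _ _) (mass _ _ _).
move: (position _ 0 actN) (position _ 0 actY) => a b NA YA YC NC.
elim/learner_ind: (act s) => -[A B C] [A' B' C'];
  rewrite ?(A, B, C) ?(A', B', C') ?mulr1 ?mulr0 => {A B C A' B' C'};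
  move: (dur s * mix s 0 actN) (dur s * mix s 0 actY) => x y a0 b0 a0' b0'.
(* Under A the first maximum is its linear argument at both ends and the second is 0. Under B both
   are 0; under C the roles are exchanged. *)
- move=> h h'.
  have z : 0 <= a - 2 * b by lra.
  have z' : 0 <= (a + x) - 2 * (b + y) by lra.
  have w : b - 2 * a <= 0 by lra.
  have w' : (b + y) - 2 * (a + x) <= 0 by lra.
  by rewrite (max_r z) (max_r z') (max_l w) (max_l w') => *; split; lra.
- move=> [h1 h2] [h1' h2'].
  have z : a - 2 * b <= 0 by lra.
  have z' : (a + x) - 2 * (b + y) <= 0 by lra.
  have w : b - 2 * a <= 0 by lra.
  have w' : (b + y) - 2 * (a + x) <= 0 by lra.
  by rewrite (max_l z) (max_l z') (max_l w) (max_l w') => *; split; lra.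
- move=> h h'.
  have z : a - 2 * b <= 0 by lra.
  have z' : (a + x) - 2 * (b + y) <= 0 by lra.
  have w : 0 <= b - 2 * a by lra.
  have w' : 0 <= (b + y) - 2 * (a + x) by lra.
  by rewrite (max_l z) (max_l z') (max_r w) (max_r w') => *; split; lra.
Qed.

(** * The explicit polytope *)

(* Rows are indexed by the optimizer's actions N, Y, columns by A, B, C. *)
Definition mx23 (R : realType) (a b c d e f : R) : 'M[R]_(2, 3) :=
  \matrix_(i, j) nth 0 [:: a; b; c; d; e; f] (3 * i + j).

Lemma halfspace_mx23 (R : realType) (a b c d e f k : R) (p : 'M[R]_(2, 3)) :
  halfspace (mx23 a b c d e f) k p <->
  a * p actN actA + b * p actN actB + c * p actN actC
  + (d * p actY actA + e * p actY actB + f * p actY actC) <= k.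
Proof. by rewrite /halfspace /= sum_optimizer !sum_learner !mxE. Qed.

Lemma mx23_eq0 (R : realType) (a b c d e f : R) :
  mx23 a b c d e f = 0 -> [/\ a = 0, b = 0 & c = 0] /\ [/\ d = 0, e = 0 & f = 0].
Proof.
move/matrixP => h; split; split.
- by have := h actN actA; rewrite !mxE.
- by have := h actN actB; rewrite !mxE.
- by have := h actN actC; rewrite !mxE.
- by have := h actY actA; rewrite !mxE.
- by have := h actY actB; rewrite !mxE.
- by have := h actY actC; rewrite !mxE.
Qed.

(** The last two inequalities bound how far play under B may leave the cone of B: an excess of 3 on
    Y needs one unit of Y under A, and an excess of 3 on N one unit of N under C. The two crossing
    paths attain equality. *)
Definition thirds_menu (R : realType) : set 'M[R]_(2, 3) :=
  [set p : 'M[R]_(2, 3) | [/\ (forall i j, 0 <= p i j),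
    \sum_i \sum_j p i j = 1,
    2 * p actY actA <= p actN actA /\ 2 * p actN actC <= p actY actC,
    p actY actB - 2 * p actN actB <= 3 * p actY actA &
    p actN actB - 2 * p actY actB <= 3 * p actN actC]]%classic.
Arguments thirds_menu : clear implicits.

Lemma thirds_menu_polytope (R : realType) : polytope (thirds_menu R).
Proof.
split.
  exists 1; split=> [|M M1 p [p0 p1 _ _ _]]; first exact: real1.
  apply: le_trans (ltW M1).
  (* The norm is the largest absolute entry, and nonnegative entries of sum 1 are at most 1. *)
  rewrite [leLHS]/Num.Def.normr /= mx_normrE bigmax_le // => -[i j] _ /=.
  rewrite ger0_norm // -p1 (bigD1 i) //= (bigD1 j) //= -addrA lerDl.
  by rewrite addr_ge0 ?sumr_ge0 // => k _; rewrite sumr_ge0.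
(* Nonnegativity of the entries NA and YC follows from the first four half-spaces. The last two
   encode that the total is 1. *)
exists [:: (mx23 0 0 0 (-1) 0 0, 0); (mx23 (-1) 0 0 2 0 0, 0);
           (mx23 0 0 (-1) 0 0 0, 0); (mx23 0 0 2 0 0 (-1), 0);
           (mx23 0 (-1) 0 0 0 0, 0); (mx23 0 0 0 0 (-1) 0, 0);
           (mx23 0 (-2) 0 (-3) 1 0, 0); (mx23 0 1 (-3) 0 (-2) 0, 0);
           (mx23 1 1 1 1 1 1, 1);
           (mx23 (-1) (-1) (-1) (-1) (-1) (-1), -1)].
split.
  apply/forall_cons; split; first by apply/eqP => /mx23_eq0 /= [[? ? ?] [? ? ?]]; lra.
  do 9![apply/forall_cons; split;
        first by apply/eqP => /mx23_eq0 /= [[? ? ?] [? ? ?]]; lra].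
  by [].
apply/seteqP; split=> p.
  move=> [p0 p1 [hA hC] hq hp].
  move: p1; rewrite sum_optimizer !sum_learner => p1.
  have [NA [NB NC]] := (p0 actN actA, (p0 actN actB, p0 actN actC)).
  have [YA [YB YC]] := (p0 actY actA, (p0 actY actB, p0 actY actC)).
  rewrite /bigcap /=.
  do 10![apply/forall_cons; split; first by apply/halfspace_mx23 => /=; lra].
  by [].
rewrite /bigcap /= => h.
move: h => /forall_cons[/halfspace_mx23 /= h0 h].
move: h => /forall_cons[/halfspace_mx23 /= h1 h].
move: h => /forall_cons[/halfspace_mx23 /= h2 h].
move: h => /forall_cons[/halfspace_mx23 /= h3 h].
move: h => /forall_cons[/halfspace_mx23 /= h4 h].
move: h => /forall_cons[/halfspace_mx23 /= h5 h].
move: h => /forall_cons[/halfspace_mx23 /= h6 h].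
move: h => /forall_cons[/halfspace_mx23 /= h7 h].
move: h => /forall_cons[/halfspace_mx23 /= h8 h].
move: h => /forall_cons[/halfspace_mx23 /= h9 h].
split.
- by elim/optimizer_ind=> j; elim/learner_ind: j; clear h; lra.
- by rewrite sum_optimizer !sum_learner; clear h; lra.
- by split; clear h; lra.
- by clear h; lra.
- by clear h; lra.
Qed.

(** * Every valid profile lies in the polytope *)

Lemma prof_thirds_menu (R : realType) (u : 'M[R]_(2, 3)) :
  thirds_rule u -> (mb_profiles u `<=` thirds_menu R)%classic.
Proof.
move=> hu _ [tau [[tau0 pt] vt ->]].
have T0 : 0 < total_time tau by exact: total_time_gt0.
have i0 : 0 < (total_time tau)^-1 by rewrite invr_gt0.
have PE i j : prof tau i j = (total_time tau)^-1 * mass tau i j.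
  by rewrite mxE.
have W0 i j := mass_ge0 i j pt.
have [] := valid_mass hu pt vt.
rewrite !position_mass !sum_learner.
move: (W0 actN actA) (W0 actN actB) (W0 actN actC).
move: (W0 actY actA) (W0 actY actB) (W0 actY actC).
move=> YA YB YC NA NB NC hA hC.
(* The equations with maxima are not convex conditions; on each choice of branches they imply these
   linear inequalities, which are homogeneous and so pass to [prof]. *)
have {}hA : [/\ 2 * mass tau actY actA <= mass tau actN actA,
  2 * mass tau actN actC <= mass tau actY actC,
  mass tau actY actB - 2 * mass tau actN actB
    <= 3 * mass tau actY actA &
  mass tau actN actB - 2 * mass tau actY actB
    <= 3 * mass tau actN actC].
  by move: hA hC; rewrite /Num.max; do ![case: ifPn => ?] => *; split; lra.
case: hA => h1 h2 h3 h4.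
split.
- by move=> i j; rewrite PE mulr_ge0 // ltW.
- under eq_bigr do under eq_bigr do rewrite PE.
  under eq_bigr do rewrite -mulr_sumr.
  by rewrite -mulr_sumr -total_time_mass // mulVf // gt_eqF.
- by rewrite !PE ![2 * _]mulrCA !ler_pM2l.
- by rewrite !PE [2 * _]mulrCA [3 * _]mulrCA -mulrBr ler_pM2l.
- by rewrite !PE [2 * _]mulrCA [3 * _]mulrCA -mulrBr ler_pM2l.
Qed.

(** * Every point of the polytope is a combination of profiles *)

Definition ray (R : realType) (a b : R) : 'rV[R]_2 :=
  \row_i nth 0 [:: a; b] i.

Lemma ray_ge0 (R : realType) (a b : R) :
  0 <= a -> 0 <= b -> forall i, 0 <= ray a b 0 i.
Proof. by move=> a0 b0; elim/optimizer_ind; rewrite mxE. Qed.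

Lemma sum_ray (R : realType) (a b : R) : \sum_i ray a b 0 i = a + b.
Proof. by rewrite sum_optimizer !mxE. Qed.

Lemma rayD (R : realType) (a b c d : R) :
  ray a b + ray c d = ray (a + c) (b + d).
Proof. by apply/matrixP => i j; elim/optimizer_ind: j; rewrite !mxE. Qed.

Lemma thirds_rule_ray (R : realType) (u : 'M[R]_(2, 3)) (a b : R) :
  thirds_rule u -> 0 <= a -> 0 <= b ->
  [/\ BR u (ray a b) actA <-> 2 * b <= a,
      BR u (ray a b) actB <-> a <= 2 * b /\ b <= 2 * a &
      BR u (ray a b) actC <-> 2 * a <= b].
Proof. by move=> hu a0 b0; have := hu _ (ray_ge0 a0 b0); rewrite !mxE. Qed.

Lemma conic_sub (R : realType) (V : lmodType R) (C D : set V) t v :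
  (C `<=` D)%classic -> conic C t v -> conic D t v.
Proof. by move=> CD [t0 [c /CD Dc ->]]; split=> //; exists c. Qed.

Lemma conic_ray (R : realType) (u : 'M[R]_(2, 3)) (a b : R) (j : 'I_3) :
  thirds_rule u -> 0 <= a -> 0 <= b -> BR u (ray a b) j ->
  conic (mb_profiles u) (a + b) (otimes (ray a b) (pure R j)).
Proof.
move=> hu a0 b0 hj; have [ab|ab] := ltP 0 (a + b).
  by rewrite -sum_ray; apply: conic_one_ray; rewrite ?sum_ray //; exact: ray_ge0.
(* The zero ray has height 0, where some profile is still required; the path (1,0) under A supplies
   one. *)
have -> : a = 0 by lra.
have -> : b = 0 by lra.
have [hA _ _] := thirds_rule_ray hu ler01 (lexx 0).
have [|||_ [c Cc _]] := conic_one_ray (u := u) (v := ray 1 0) (j := actA).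
- by apply: ray_ge0.
- by rewrite sum_ray; lra.
- by apply/hA; lra.
split; first by rewrite addr0.
exists c => //; rewrite addr0 scale0r; apply/matrixP => i k.
by rewrite otimes_pureE !mxE; elim/optimizer_ind: i; rewrite mul0r.
Qed.

Lemma conic_ray_ray (R : realType) (u : 'M[R]_(2, 3)) (a b c d : R)
    (j k : 'I_3) :
  0 <= a -> 0 <= b -> 0 <= c -> 0 <= d -> 0 < a + b -> 0 < c + d ->
  BR u (ray a b) j -> BR u (ray a b) k ->
  BR u (ray (a + c) (b + d)) k ->
  conic (mb_profiles u) (a + b + (c + d))
    (otimes (ray a b) (pure R j) + otimes (ray c d) (pure R k)).
Proof.
move=> a0 b0 c0 d0 ab cd hj hk hk'; rewrite -(sum_ray a b) -(sum_ray c d).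
by apply: conic_two_rays; rewrite ?sum_ray ?rayD //; exact: ray_ge0.
Qed.

Lemma thirds_menu_sub_hull (R : realType) (u : 'M[R]_(2, 3)) :
  thirds_rule u ->
  (thirds_menu R `<=` convex_hull (mb_profiles u))%classic.
Proof.
move=> hu p [p0 p1 [hA hC] hY hN].
set C := convex_hull _.
have cC : convex_set (C : set (convex_lmodType _)) by exact: convex_hull_convex.
have SC := sub_convex_hull (S := mb_profiles u).
move: p1; rewrite sum_optimizer !sum_learner => p1.
have := p0 actN actA; have := p0 actN actB; have := p0 actN actC.
have := p0 actY actA; have := p0 actY actB; have := p0 actY actC.
move=> YC YB YA NC NB NA.
(* [s] and [t] are the multiples of the A-then-B and C-then-B crossing paths to remove. Each is one
   third of the excess of the B column beyond the corresponding boundary, so the remainder lands on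
   that boundary; at most one is nonzero. *)
have [s [t [[s0 t0] [sA tC] [tN sY] hB]]] : exists s t : R,
  [/\ 0 <= s /\ 0 <= t, s <= p actY actA /\ t <= p actN actC,
    3 * t <= p actN actB /\ 3 * s <= p actY actB &
    p actN actB - 3 * t <= 2 * (p actY actB - 3 * s) /\
    p actY actB - 3 * s <= 2 * (p actN actB - 3 * t)].
  have [h|h] := ltP (2 * p actN actB) (p actY actB).
    exists ((p actY actB - 2 * p actN actB) / 3), 0.
    by split; split; lra.
  have [h'|h'] := ltP (2 * p actY actB) (p actN actB).
    exists 0, ((p actN actB - 2 * p actY actB) / 3).
    by split; split; lra.
  by exists 0, 0; split; split; lra.
(* Removing [s] times (2,1) from the A column moves it parallel to the boundary ray, so it stays in
   the cone of A; likewise for C with (1,2). *)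
have kA : conic C (p actN actA - 2 * s + (p actY actA - s))
    (otimes (ray (p actN actA - 2 * s) (p actY actA - s)) (pure R actA)).
  apply: conic_sub SC _; apply: conic_ray => //; [lra..|].
  have [||h _ _] :=
    thirds_rule_ray (a := (p actN actA - 2 * s)) (b := (p actY actA - s)) hu.
  - by lra.
  - by lra.
  - by apply/h; lra.
have kB : conic C (p actN actB - 3 * t + (p actY actB - 3 * s))
    (otimes (ray (p actN actB - 3 * t) (p actY actB - 3 * s)) (pure R actB)).
  apply: conic_sub SC _; apply: conic_ray => //; [lra..|].
  have [||_ h _] :=
    thirds_rule_ray (a := (p actN actB - 3 * t)) (b := (p actY actB - 3 * s)) hu.
  - by lra.
  - by lra.
  - by apply/h.
have kC : conic C (p actN actC - t + (p actY actC - 2 * t))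
    (otimes (ray (p actN actC - t) (p actY actC - 2 * t)) (pure R actC)).
  apply: conic_sub SC _; apply: conic_ray => //; [lra..|].
  have [||_ _ h] :=
    thirds_rule_ray (a := (p actN actC - t)) (b := (p actY actC - 2 * t)) hu.
  - by lra.
  - by lra.
  - by apply/h; lra.
have kAB : conic C (2 + 1 + (0 + 3))
   (otimes (ray 2 1) (pure R actA) + otimes (ray 0 3) (pure R actB)).
  (* A and B tie at (2,1), and the endpoint (2,4) lies on the other boundary ray of B. *)
  have [||h1 h2 _] := thirds_rule_ray (a := 2) (b := 1) hu; [lra..|].
  have [||_ h3 _] := thirds_rule_ray (a := (2 + 0)) (b := (1 + 3)) hu; [lra..|].
  apply: conic_sub SC _; apply: conic_ray_ray; try lra.
  - by apply/h1; lra.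
  - by apply/h2; lra.
  - by apply/h3; lra.
have kCB : conic C (1 + 2 + (3 + 0))
   (otimes (ray 1 2) (pure R actC) + otimes (ray 3 0) (pure R actB)).
  have [||_ h2 h1] := thirds_rule_ray (a := 1) (b := 2) hu; [lra..|].
  have [||_ h3 _] := thirds_rule_ray (a := (1 + 3)) (b := (2 + 0)) hu; [lra..|].
  apply: conic_sub SC _; apply: conic_ray_ray; try lra.
  - by apply/h1; lra.
  - by apply/h2; lra.
  - by apply/h3; lra.
have kABC := conic_add cC kA (conic_add cC kB kC).
have kG := conic_add cC (conicZ s0 kAB)
                                    (conicZ t0 kCB).
have [_ [c Cc]] := conic_add cC kABC kG.
(* The heights add up to the sum of the entries of [p], which is 1. *)
set w := (X in X *: c); have -> : w = 1 by rewrite /w; lra.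
rewrite scale1r => E; suff -> : p = c by [].
rewrite -E; apply/matrixP => i j.
rewrite !(otimes_pureE, mxE).
by elim/optimizer_ind: i; elim/learner_ind: j; rewrite /=; ring.
Qed.

Theorem theorem5p11 (R : realType) (uL : 'M[R]_(2, 3))
    (hNA : uL actN actA = 0) (hYA : uL actY actA = 0)
    (hNB : uL actN actB = - (1 / 6)) (hYB : uL actY actB = 1 / 3)
    (hNC : uL actN actC = - (1 / 2)) (hYC : uL actY actC = 1 / 2) :
  polytope (mb_menu uL).
Proof.
have hu := thirds_rule_uL hNA hYA hNB hYB hNC hYC.
have P := thirds_menu_polytope R.
rewrite /mb_menu (_ : closure _ = thirds_menu R) //.
apply: polytope_hull_closure P _ _; first exact: prof_thirds_menu.
exact: thirds_menu_sub_hull.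
Qed.
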